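(* Let $\lambda\geq3$ be an integer, and let $S\subseteq\{0,1\}^n$ be such that its convex hull satisfies $\mathrm{conv}(S)\supseteq\big[\tfrac1\lambda,1-\tfrac1\lambda\big]^n$. Then $|S|\geq2^{(1-H(1/\lambda))n}$.
   Context: $H$ is the binary entropy function $H(\varepsilon)=-\varepsilon\log_2\varepsilon-(1-\varepsilon)\log_2(1-\varepsilon)$ for $\varepsilon\in(0,\tfrac12]$, $H(0)=0$. *)

(* Defs.v *)
From HB Require Import structures.
From mathcomp Require Import all_boot all_order all_algebra.
From mathcomp Require Import all_classical all_reals all_analysis.

Set Implicit Arguments.
Unset Strict Implicit.
Unset Printing Implicit Defensive.

Import Order.TTheory GRing.Theory Num.Theory.

Local Open Scope classical_set_scope.
Local Open Scope ring_scope.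

Definition log2 (R : realType) (x : R) : R := ln x / ln 2.

(* The intended domain is 0 <= e <= 1/2. *)
Definition binary_entropy (R : realType) (e : R) : R :=
  if e == 0 then 0 else - e * log2 e - (1 - e) * log2 (1 - e).

Definition convex_hull (R : numDomainType) (E : lmodType R) (A : set E) : set E :=
  smallest (@convex_set R E) A.

(* The inclusion of {0,1}^n in R^n; 'rV[bool]_n is a finite type, so that
   subsets of {0,1}^n are finite sets with a cardinal. *)
Definition bool_point (R : realType) (n : nat) (v : 'rV[bool]_n) : 'rV[R]_n :=
  map_mx (fun b : bool => b%:R) v.

Definition box (R : realType) (n : nat) (a b : R) : set 'rV[R]_n :=
  [set x | forall i, a <= x ord0 i <= b].

Arguments bool_point R {n} v.
Arguments box {R} n a b.

(* Main.v *)
(* Write e for 1/lambda. For a vertex v of the cube, the point of {e, 1 - e}^n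
   nearest to v lies in the convex hull of S. The log-likelihood of a received
   word under the binary symmetric channel with input v and crossover
   probability e extends to an affine function of the word, whose value at this
   point is - H(e) n ln 2. Hence some s in S is received from v with probability
   at least 2^(- H(e) n). Summing over the 2^n vertices v, where each s has total
   probability 1 by symmetry of the channel, gives 2^n 2^(- H(e) n) <= |S|. *)
Require Import Defs.
From HB Require Import structures.
From mathcomp Require Import all_boot all_order all_algebra.
From mathcomp Require Import all_classical all_reals all_analysis.
From mathcomp Require Import ring lra.

Import Order.TTheory GRing.Theory Num.Theory.

Local Open Scope classical_set_scope.
Local Open Scope ring_scope.

(** Otherwise the strict sublevel set of [f] at level [f x] would be a convex set containing [A], so
    it would contain the hull and thus [x] itself. *)
Lemma convex_function_le_hull (R : realType) (E : lmodType R) (A : set E)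
    (f : E -> R) (x : E) :
  convex_function setT f -> convex_hull A x -> exists2 a, A a & f x <= f a.
Proof.
move=> cvxf Ax; apply: contrapT => nA.
suff : f x < f x by rewrite ltxx.
apply: (Ax [set y | f y < f x]); split => [|a Aa]; last first.
  by rewrite /= ltNge; apply/negP => le_fxa; apply: nA; exists a.
apply/convex_setW => y z; rewrite !inE /= => fy fz k k0 k1; rewrite inE /=.
apply: (le_lt_trans (cvxf k y z (in_setT _) (in_setT _))).
rewrite convRE /unstable.onem; nra.
Qed.

Section binary_symmetric_channel.
Context {R : realType} (e : R).

Definition bit_loglik (b : bool) (x : R) : R :=
  if b then x * ln (1 - e) + (1 - x) * ln e
  else x * ln e + (1 - x) * ln (1 - e).

Definition loglik {n : nat} (v : 'rV[bool]_n) (x : 'rV[R]_n) : R :=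
  \sum_i bit_loglik (v ord0 i) (x ord0 i).

Definition noisy_vertex {n : nat} (v : 'rV[bool]_n) : 'rV[R]_n :=
  \row_i if v ord0 i then 1 - e else e.

Lemma convex_loglik (n : nat) (v : 'rV[bool]_n) : convex_function setT (loglik v).
Proof.
move=> t x y _ _; rewrite convRE /loglik !mulr_sumr -big_split /=.
apply: ler_sum => i _; rewrite !mxE /bit_loglik /unstable.onem.
(* [bit_loglik] is affine in [x], so the convexity inequality is an equality. *)
by case: (v ord0 i); rewrite le_eqVlt; apply/orP; left; apply/eqP; ring.
Qed.

Lemma box_noisy_vertex (n : nat) (v : 'rV[bool]_n) :
  e <= 2^-1 -> box n e (1 - e) (noisy_vertex v).
Proof.
by move=> e2 i; rewrite mxE; case: (v ord0 i); apply/andP; split; lra.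
Qed.

Hypotheses (e_gt0 : 0 < e) (e_lt1 : e < 1).

(** Whichever bit [v] has, a coordinate contributes (1 - e) ln (1 - e) + e ln e = - H(e) ln 2. *)
Lemma loglik_noisy_vertex (n : nat) (v : 'rV[bool]_n) :
  loglik v (noisy_vertex v) = - binary_entropy e * n%:R * ln 2.
Proof.
rewrite /loglik (eq_bigr (fun=> - binary_entropy e * ln 2)) => [|i _].
  by rewrite sumr_const card_ord mulrAC -[LHS]mulr_natr.
have ln2_neq0 : ln 2 != 0 :> R by rewrite gt_eqF // ln_gt0 // ltr1n.
rewrite mxE /bit_loglik /binary_entropy gt_eqF // /log2.
by case: (v ord0 i); field.
Qed.

Lemma expR_bit_loglik (b c : bool) :
  expR (bit_loglik b c%:R) = if b == c then 1 - e else e.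
Proof.
have e1_gt0 : 0 < 1 - e by rewrite subr_gt0.
by case: b c => [] []; rewrite /bit_loglik /= ?subr0 ?subrr ?mul1r ?mul0r
  ?addr0 ?add0r lnK // posrE.
Qed.

(** The sum runs over channel inputs, not outputs; by symmetry each coordinate still gives the
    factor (1 - e) + e = 1. *)
Lemma sum_expR_loglik (n : nat) (s : 'rV[bool]_n) :
  \sum_v expR (loglik v (bool_point R s)) = 1.
Proof.
(* Rows are reindexed by functions so that the sum of products factors into sums over one bit. *)
pose row_of (f : {ffun 'I_n -> bool}) : 'rV[bool]_n := \row_i f i.
have row_of_bij : bijective row_of.
  exists (fun v : 'rV[bool]_n => [ffun i => v ord0 i]) => [f|v].
    by apply/ffunP => i; rewrite ffunE mxE.
  by apply/rowP => i; rewrite mxE ffunE.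
rewrite (reindex row_of) /=; last exact: onW_bij.
pose F i b := expR (bit_loglik b (s ord0 i)%:R).
transitivity (\sum_(f : {ffun 'I_n -> bool}) \prod_i F i (f i)).
  by apply: eq_bigr => f _; rewrite expR_sum; apply: eq_bigr => i _; rewrite !mxE.
rewrite -bigA_distr_bigA big1 // => i _.
rewrite big_bool /F !expR_bit_loglik.
by case: (s ord0 i); rewrite /= ?subrK // addrC subrK.
Qed.

Lemma card_ge_entropy (n : nat) (S : {set 'rV[bool]_n}) :
  e <= 2^-1 -> box n e (1 - e) `<=` convex_hull (bool_point R @` [set` S]) ->
  2 `^ ((1 - binary_entropy e) * n%:R) <= #|S|%:R.
Proof.
move=> e2 hS.
(* The factor 2^n counts the vertices: each gets an equal share of the bound. *)
have -> : 2 `^ ((1 - binary_entropy e) * n%:R)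
    = \sum_(v : 'rV[bool]_n) expR (- binary_entropy e * n%:R * ln 2) :> R.
  rewrite sumr_const card_mx card_bool mul1n -[RHS]mulr_natl natrX.
  rewrite -powR_mulrn // /powR pnatr_eq0 /= -expRD.
  by congr expR; ring.
have -> : #|S|%:R = \sum_v \sum_(s in S) expR (loglik v (bool_point R s)) :> R.
  rewrite exchange_big /= (eq_bigr (fun=> 1)) => [|s _]; last exact: sum_expR_loglik.
  by rewrite sumr_const.
apply: ler_sum => v _; rewrite -(loglik_noisy_vertex _ v).
have [_ [s sS <-] le_s] := convex_function_le_hull _ _ _ _ _ (convex_loglik _ v)
  (hS _ (box_noisy_vertex _ v e2)).
(* The term of this [s] suffices, the others being nonnegative. *)
rewrite (bigD1 s) //= ler_wpDr ?ler_expR //.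
by apply: sumr_ge0 => t _; rewrite expR_ge0.
Qed.

End binary_symmetric_channel.

Theorem theorem2p3 (R : realType) (lambda n : nat) (S : {set 'rV[bool]_n})
    (hlambda : (3 <= lambda)%N)
    (hS : box n (lambda%:R^-1 : R) (1 - lambda%:R^-1)
          `<=` convex_hull (bool_point R @` [set` S])) :
  2 `^ ((1 - binary_entropy (lambda%:R^-1 : R)) * n%:R) <= #|S|%:R.
Proof.
have lambda_gt0 : 0 < lambda%:R :> R by rewrite ltr0n (leq_trans _ hlambda).
have e2 : lambda%:R^-1 <= 2^-1 :> R.
  by rewrite lef_pV2 ?posrE // ler_nat ltnW.
apply: card_ge_entropy => //; first by rewrite invr_gt0.
by apply: le_lt_trans e2 _; rewrite invf_lt1 // ltr1n.
Qed.
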